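(* Let $\mathbb{F}$ be a field of any characteristic, let $A$ be a commutative associative $\mathbb{F}$-algebra with identity element, and let $D$ be a nonzero $\mathbb{F}$-vector space spanned by some pairwise commuting $\mathbb{F}$-derivations of $A$. Let $A[D]=A\otimes_{\mathbb{F}}\mathbb{F}[D]$ be the associated algebra of Weyl type, $\mathbb{F}_1=\{u\in A : \partial(u)=0 \text{ for all } \partial\in D\}$, and let $\overline{A}[D]=A[D]/\mathbb{F}_1$ be the quotient of the Lie algebra $(A[D],[\cdot,\cdot])$ by the central subspace $\mathbb{F}_1$. Then the Lie algebra $\overline{A}[D]$ is simple if and only if $A$ is $D$-simple and $\mathbb{F}_1[D]$ acts faithfully on $A$.
   Context: Let $\{\partial_i\mid i\in I\}$ be an $\mathbb{F}$-basis of $D$ (with $I$ totally ordered), and let $J$ be the set of all families $\alpha=(\alpha_i)_{i\in I}$ of nonnegative integers with $\alpha_i=0$ for all but finitely many $i$. $\mathbb{F}[D]$ denotes the (formal, commutative) polynomial algebra in the variables $\partial_i$, with basis the monomials $\partial^{(\alpha)}=\prod_{i\in I}\partial_i^{\alpha_i}$, $\alpha\in J$. The vector space $A[D]=A\otimes_{\mathbb{F}}\mathbb{F}[D]$ acts on $A$ by $(u\otimes\partial^{(\alpha)})(x)=u\cdot\big(\prod_{i}\partial_i^{\alpha_i}\big)(x)$ for $u,x\in A$, where the product is composition of the derivations; this gives a linear map $\theta:A[D]\to \mathrm{Hom}_{\mathbb{F}}(A,A)$. The associative product on $A[D]$ is $$(u\otimes\partial^{(\alpha)})\cdot(v\otimes\partial^{(\beta)})=u\sum_{\gamma\in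 J,\ \gamma_i\le\alpha_i\ \forall i}\binom{\alpha}{\gamma}\,\partial^{(\gamma)}(v)\otimes\partial^{(\alpha+\beta-\gamma)},\qquad \binom{\alpha}{\gamma}=\prod_{i\in I}\binom{\alpha_i}{\gamma_i},$$ so that $\theta$ is a homomorphism of associative algebras. The Lie bracket is $[x,y]=x\cdot y-y\cdot x$. $\mathbb{F}_1$ is identified with $\mathbb{F}_1\otimes 1\subset A[D]$; it lies in the center of the Lie algebra $A[D]$. $\mathbb{F}_1[D]$ denotes the subspace $\mathbb{F}_1\otimes_{\mathbb{F}}\mathbb{F}[D]$ of $A[D]$; a subspace of $A[D]$ acts faithfully on $A$ if the restriction of $\theta$ to it is injective. $A$ is $D$-simple if $A$ has no ideals $\mathcal{I}$ other than $0$ and $A$ with $\partial(\mathcal{I})\subseteq\mathcal{I}$ for all $\partial\in D$. *)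

(* Defs.v *)
From HB Require Import structures.
From mathcomp Require Import all_boot all_algebra.
From mathcomp Require Import generic_quotient ring_quotient finmap.
From mathcomp Require Import boolp classical_sets functions cardinality fsbigop.
From mathcomp.multinomials Require Import monalg.

Set Implicit Arguments.
Unset Strict Implicit.
Unset Printing Implicit Defensive.

Import GRing.Theory.
Local Open Scope classical_set_scope.
Local Open Scope ring_scope.
Local Open Scope quotient_scope.

Section LinearAlgebra.
Context (F : fieldType) (V : lmodType F).

Definition lin_span (S : set V) : set V :=
  [set v | exists n (c : 'I_n -> F) (w : 'I_n -> V),
      (forall i, S (w i)) /\ v = \sum_(i < n) c i *: w i].

Definition lin_indep (I : choiceType) (e : I -> V) : Prop :=
  forall (s : seq I) (c : I -> F), uniq s ->
    \sum_(i <- s) c i *: e i = 0 -> {in s, forall i, c i = 0}.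

Definition is_basis (I : choiceType) (W : set V) (e : I -> V) : Prop :=
  lin_indep e /\ W = lin_span (range e).

Definition subspace (W : set V) : Prop :=
  W 0 /\ forall (c : F) x y, W x -> W y -> W (c *: x + y).

Section Lie.
Context (br : V -> V -> V).

Definition lie_ideal (N : set V) : Prop :=
  subspace N /\ forall x y, N y -> N (br x y) /\ N (br y x).

(* An ideal is required to be stable on both sides, and a simple algebra to be
   non-abelian; no bilinearity or Jacobi identity is assumed of [br] here. *)
Definition lie_simple : Prop :=
  (exists x y, br x y <> 0) /\
  forall N : set V, lie_ideal N -> N = [set 0] \/ N = setT.
End Lie.

End LinearAlgebra.

Section QuotientSpace.
Context (F : fieldType) (V : lmodType F) (W : set V) (hW : subspace W).

(* [hW] is a phantom argument: it lets the closure instance be inferred. *)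
Definition subspace_mem of subspace W : {pred V} := fun v => `[< W v >].

Fact subspace_mem_zmod_closed : zmod_closed (subspace_mem hW).
Proof.
case: hW => W0 WD; split=> [|x y /asboolP Wx /asboolP Wy]; apply/asboolP => //.
by rewrite addrC -scaleN1r; exact: WD.
Qed.
HB.instance Definition _ :=
  GRing.isZmodClosed.Build V (subspace_mem hW) subspace_mem_zmod_closed.

Definition quotsp : Type := Quotient.quot (subspace_mem hW).
HB.instance Definition _ := EqQuotient.on quotsp.
HB.instance Definition _ := GRing.Zmodule.on quotsp.

Definition to_quotsp (v : V) : quotsp := \pi_quotsp v.

Lemma to_quotspP x y : to_quotsp x = to_quotsp y <-> W (x - y).
Proof.
split; first by move/eqP; rewrite -Quotient.idealrBE => /asboolP.
by move=> h; apply/eqP; rewrite -Quotient.idealrBE; apply/asboolP.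
Qed.

Lemma to_quotspD x y : to_quotsp (x + y) = to_quotsp x + to_quotsp y.
Proof. exact: (Quotient.pi_add (subspace_mem hW) x y). Qed.

Lemma to_quotsp_repr (q : quotsp) : to_quotsp (repr q) = q.
Proof. exact: reprK. Qed.

Definition quotsp_scale (c : F) (q : quotsp) : quotsp :=
  to_quotsp (c *: repr q).

Lemma to_quotspZ c v : to_quotsp (c *: v) = quotsp_scale c (to_quotsp v).
Proof.
apply/to_quotspP; rewrite -scalerBr -[X in W X]addr0.
case: (hW) => W0 WD; apply: WD => //.
by apply/to_quotspP; rewrite to_quotsp_repr.
Qed.

Fact quotsp_scaleA a b q :
  quotsp_scale a (quotsp_scale b q) = quotsp_scale (a * b) q.
Proof. by rewrite -[q]to_quotsp_repr -!to_quotspZ scalerA. Qed.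
Fact quotsp_scale1 : left_id 1 quotsp_scale.
Proof. by move=> q; rewrite -[q]to_quotsp_repr -to_quotspZ scale1r. Qed.
Fact quotsp_scaleDr : right_distributive quotsp_scale +%R.
Proof.
move=> a p q; rewrite -[p]to_quotsp_repr -[q]to_quotsp_repr -to_quotspD.
by rewrite -!to_quotspZ -to_quotspD scalerDr.
Qed.
Fact quotsp_scaleDl q : {morph quotsp_scale^~ q : a b / a + b}.
Proof.
by move=> a b; rewrite -[q]to_quotsp_repr -!to_quotspZ -to_quotspD scalerDl.
Qed.
HB.instance Definition _ := GRing.Zmodule_isLmodule.Build F quotsp
  quotsp_scaleA quotsp_scale1 quotsp_scaleDr quotsp_scaleDl.

End QuotientSpace.

Section Derivations.
Context (F : fieldType) (A : comAlgType F).

Definition derivation (d : A -> A) : Prop :=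
  (forall (c : F) x y, d (c *: x + y) = c *: d x + d y) /\
  (forall x y, d (x * y) = d x * y + x * d y).

Definition spanned_by_commuting_ders (D : set (A -> A)) : Prop :=
  exists S : set (A -> A),
    [/\ forall d, S d -> derivation d,
        forall d e, S d -> S e -> d \o e = e \o d &
        D = lin_span S].

Context (D : set (A -> A)).

Definition consts : set A := [set u | forall d, D d -> d u = 0].

Definition D_simple : Prop :=
  forall J : set A,
    J 0 -> (forall x y, J x -> J y -> J (x + y)) ->
    (forall a x, J x -> J (a * x)) ->
    (forall d x, D d -> J x -> J (d x)) ->
    J = [set 0] \/ J = setT.

Lemma spanned_derivation d : spanned_by_commuting_ders D -> D d -> derivation d.
Proof.
move=> [S [derS _ ->]] [n [c [w [Sw ->]]]].
have E x : (\sum_(i < n) c i *: w i) x = \sum_(i < n) c i *: w i x.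
  by rewrite fct_sumE.
split=> [a x y|x y]; rewrite !E.
  rewrite scaler_sumr -big_split; apply: eq_bigr => i _ /=.
  by rewrite (derS _ (Sw i)).1 scalerDr !scalerA mulrC.
rewrite mulr_suml mulr_sumr -big_split; apply: eq_bigr => i _ /=.
by rewrite (derS _ (Sw i)).2 scalerDr scalerAl scalerAr.
Qed.

End Derivations.

Section WeylAlgebra.
Context (F : fieldType) (A : comAlgType F) (I : choiceType).

(* A[D] = A (x) F[D] has the A-basis of monomials d^(a), a in J = {cmonom I};
   the alias carries its F-linear structure instead of the A-linear one.
   The ring structure of {malg A[_]} is not the product of A[D]. *)
Definition weyl : Type := {malg A[{cmonom I}]}.
HB.instance Definition _ := GRing.Zmodule.on weyl.

Definition weyl_scale (c : F) (f : weyl) : weyl :=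
  (c%:A : A) *: (f : {malg A[{cmonom I}]}).

Fact weyl_scaleA a b f : weyl_scale a (weyl_scale b f) = weyl_scale (a * b) f.
Proof. by rewrite /weyl_scale scalerA -scalerAl mul1r scalerA. Qed.
Fact weyl_scale1 : left_id 1 weyl_scale.
Proof. by move=> f; rewrite /weyl_scale scale1r; exact: scale1r. Qed.
Fact weyl_scaleDr : right_distributive weyl_scale +%R.
Proof. by move=> a f g; exact: scalerDr. Qed.
Fact weyl_scaleDl f : {morph weyl_scale^~ f : a b / a + b}.
Proof. by move=> a b; rewrite /weyl_scale scalerDl; exact: scalerDl. Qed.
HB.instance Definition _ := GRing.Zmodule_isLmodule.Build F weyl
  weyl_scaleA weyl_scale1 weyl_scaleDr weyl_scaleDl.

Definition wmon (u : A) (a : {cmonom I}) : weyl := << u *g a >>.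
Definition wcoef (f : weyl) (a : {cmonom I}) : A := mcoeff a f.
Definition wsupp (f : weyl) : {fset {cmonom I}} := msupp f.

Lemma weylP f g : wcoef f =1 wcoef g -> f = g.
Proof. by move=> fg; apply/malgP. Qed.

Lemma wcoefZ c f a : wcoef (c *: f) a = c *: wcoef f a.
Proof.
rewrite /wcoef [c *: f]/(weyl_scale c f) /weyl_scale.
by rewrite mcoeffZ -scalerAl mul1r.
Qed.

Lemma wcoefD f g a : wcoef (f + g) a = wcoef f a + wcoef g a.
Proof. exact: mcoeffD. Qed.

Lemma wcoef_mon u a b : wcoef (wmon u a) b = u *+ (a == b).
Proof. exact: mcoeffU. Qed.

Lemma wmonP (c : F) (u v : A) a :
  wmon (c *: u + v) a = c *: wmon u a + wmon v a.
Proof.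
apply: weylP => b; rewrite wcoefD wcoefZ.
rewrite [LHS]wcoef_mon [X in _ = _ *: X + _]wcoef_mon.
rewrite [X in _ = _ + X]wcoef_mon.
by rewrite mulrnDl scalerMnr.
Qed.

Definition mon_le (c a : {cmonom I}) : Prop := forall i, (c i <= a i)%N.

(* The factors with [i] outside [finsupp a] are 'C(0, c i), equal to 1 when
   [mon_le c a], the only case used. *)
Definition mon_bin (a c : {cmonom I}) : nat :=
  (\prod_(i <- finsupp a) 'C(a i, c i))%N.

Context (del : I -> A -> A).

(* The order of the factors is immaterial as the [del i] commute. *)
Definition del_pow (a : {cmonom I}) : A -> A :=
  \big[comp/id]_(i <- finsupp a) iter (a i) (del i).

Definition theta (f : weyl) : A -> A :=
  fun x => \sum_(a <- wsupp f) wcoef f a * del_pow a x.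

Definition acts_faithfully (X : set weyl) : Prop :=
  forall f g, X f -> X g -> theta f = theta g -> f = g.

(* The divisors of [a] form a finite set (mon_le_finite), so no term is lost
   by the finitely supported sum. *)
Definition wmon_mul (u : A) (a : {cmonom I}) (v : A) (b : {cmonom I}) : weyl :=
  \sum_(c \in [set c | mon_le c a])
     wmon (u * ((mon_bin a c)%:R * del_pow c v)) (divcm (mulcm a b) c).

Definition weyl_mul (f g : weyl) : weyl :=
  \sum_(a <- wsupp f) \sum_(b <- wsupp g)
     wmon_mul (wcoef f a) a (wcoef g b) b.

Definition weyl_lie (f g : weyl) : weyl := weyl_mul f g - weyl_mul g f.

Lemma mon_le_finite (a : {cmonom I}) : finite_set [set c | mon_le c a].
Proof.
pose T := {ffun finsupp a -> 'I_(\max_(i : finsupp a) a (val i)).+1}.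
pose g (h : T) : {cmonom I} :=
  mkcmonom [fsfun i : finsupp a => (h i : nat) | 0%N].
apply: (@sub_finite_set _ _ (g @` setT)); last exact/finite_image/finite_finset.
move=> c /= ca; exists [ffun i : finsupp a => inord (c (val i))] => //.
apply/eqP/cmP => i; rewrite cmE fsfun_ffun.
case: insubP => [u _ <-|ia] /=.
  rewrite ffunE inordK // ltnS (leq_trans (ca _)) //.
  exact: (leq_bigmax u).
by move: ia (ca i); rewrite memNfinsupp => /eqP ->; rewrite leqn0 => /eqP ->.
Qed.

Lemma wmon_mul_sum u a v b : wmon_mul u a v b =
  \sum_(c <- fset_set [set c | mon_le c a])
     wmon (u * ((mon_bin a c)%:R * del_pow c v)) (divcm (mulcm a b) c).
Proof. by rewrite /wmon_mul fsbig_finite //; exact: mon_le_finite. Qed.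

Lemma wmonB u v a : wmon (u - v) a = wmon u a - wmon v a.
Proof. exact: monalgUB. Qed.

Lemma wmon_mulBl a v b : {morph (fun u => wmon_mul u a v b) : x y / x - y}.
Proof.
move=> x y; rewrite !wmon_mul_sum -sumrB; apply: eq_bigr => c _.
by rewrite mulrBl wmonB.
Qed.

Hypothesis derdel : forall i, derivation (del i).

Lemma del_powB c x y : del_pow c (x - y) = del_pow c x - del_pow c y.
Proof.
rewrite /del_pow; elim: (X in bigop.body _ X) => [|i s IH].
  by rewrite !big_nil.
rewrite !big_cons /= IH; elim: (c i) => //= n ->.
by rewrite addrC -scaleN1r (derdel i).1 scaleN1r addrC.
Qed.

Lemma wmon_mulBr u a b : {morph (fun v => wmon_mul u a v b) : x y / x - y}.
Proof.
move=> x y; rewrite !wmon_mul_sum -sumrB; apply: eq_bigr => c _.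
by rewrite del_powB !mulrBr wmonB.
Qed.

Lemma wmon_mul0l a v b : wmon_mul 0 a v b = 0.
Proof. by have := wmon_mulBl a v b 0 0; rewrite /= !subrr. Qed.

Lemma wmon_mul0r u a b : wmon_mul u a 0 b = 0.
Proof. by have := wmon_mulBr u a b 0 0; rewrite /= !subrr. Qed.

Lemma weyl_mulEw (X Y : {fset {cmonom I}}) f g :
  (wsupp f `<=` X)%fset -> (wsupp g `<=` Y)%fset ->
  weyl_mul f g =
  \sum_(a <- X) \sum_(b <- Y) wmon_mul (wcoef f a) a (wcoef g b) b.
Proof.
move=> fX gY; rewrite /weyl_mul.
rewrite (big_fset_incl _ fX) => [|a _ /mcoeff_outdom a0]; last first.
  by rewrite /wcoef a0 big1 // => b _; rewrite wmon_mul0l.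
apply: eq_bigr => a _; apply: (big_fset_incl _ gY) => b _ /mcoeff_outdom b0.
by rewrite /wcoef b0 wmon_mul0r.
Qed.

Lemma weyl_mulBl f g h : weyl_mul (f - g) h = weyl_mul f h - weyl_mul g h.
Proof.
pose X := (wsupp f `|` wsupp g)%fset.
rewrite !(@weyl_mulEw X (wsupp h)) ?fsubsetUl ?fsubsetUr //;
  last exact: msuppB_le.
rewrite -sumrB; apply: eq_bigr => a _; rewrite -sumrB; apply: eq_bigr => b _.
by rewrite -wmon_mulBl /wcoef mcoeffB.
Qed.

Lemma weyl_mulBr f g h : weyl_mul h (f - g) = weyl_mul h f - weyl_mul h g.
Proof.
pose X := (wsupp f `|` wsupp g)%fset.
rewrite !(@weyl_mulEw (wsupp h) X) ?fsubsetUl ?fsubsetUr //;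
  last exact: msuppB_le.
rewrite -sumrB; apply: eq_bigr => a _; rewrite -sumrB; apply: eq_bigr => b _.
by rewrite -wmon_mulBr /wcoef mcoeffB.
Qed.

Lemma weyl_lieBl f g h : weyl_lie (f - g) h = weyl_lie f h - weyl_lie g h.
Proof.
have E (V : zmodType) (x y z t : V) : x - y - (z - t) = x - z - (y - t).
  by rewrite !opprD !opprK addrACA.
by rewrite /weyl_lie weyl_mulBl weyl_mulBr; exact: E.
Qed.

Lemma weyl_lieN f g : weyl_lie g f = - weyl_lie f g.
Proof. by rewrite /weyl_lie opprB. Qed.

Lemma mon_le_refl a : mon_le a a. Proof. by []. Qed.

Lemma mon_le1 a : mon_le mone a.
Proof. by move=> i; rewrite cm1. Qed.

Lemma del_pow1 x : del_pow mone x = x.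
Proof. by rewrite /del_pow mdom1 big_nil. Qed.

Lemma mon_bin1 a : mon_bin a mone = 1%N.
Proof. by rewrite /mon_bin big1 // => i _; rewrite cm1 bin0. Qed.

Lemma divcm1 (a : {cmonom I}) : divcm a mone = a.
Proof. by apply/eqP/cmP => i; rewrite divcmE cm1 subn0. Qed.

Lemma del_pow_const c u : (forall i, del i u = 0) -> c <> mone ->
  del_pow c u = 0.
Proof.
move=> du c1; have d0 i : del i 0 = 0.
  by have := (derdel i).1 (-1) 0 0; rewrite scaler0 addr0 scaleN1r addNr.
have it n i : iter n (del i) u = u *+ (n == 0).
  by elim: n => //= n ->; case: n => [|n]; rewrite ?mulr1n ?mulr0n ?du ?d0.
have it0 n i : iter n (del i) 0 = 0 by elim: n => //= n ->.
have E s : all (fun i => c i != 0%N) s ->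
    (\big[comp/id]_(i <- s) iter (c i) (del i)) u = u *+ nilp s.
  elim: s => [|i s IH] /=; first by rewrite big_nil.
  move=> /andP[ci cs]; rewrite big_cons /= IH //.
  by case: (nilp s); rewrite ?it ?(negPf ci) // mulr0n it0.
rewrite /del_pow E; last by apply/allP => i; rewrite mem_finsupp.
have [/nilP s0|//] := boolP (nilp _); case: c1; apply/eqP/cmP => i.
rewrite cm1; apply/eqP; rewrite -memNfinsupp.
by rewrite [_ \in _]/(i \in (finsupp c : seq I)) s0.
Qed.

Lemma wmon_mul_constl u v b : wmon_mul u mone v b = wmon (u * v) b.
Proof.
rewrite wmon_mul_sum (_ : [set c | mon_le c mone] = [set mone]); last first.
  apply/seteqP; split=> c /= => [c1|->]; last exact: mon_le_refl.
  by apply/eqP/cmP => i; have := c1 i; rewrite !cm1 leqn0 => /eqP.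
rewrite fset_set1 big_seq_fset1 mon_bin1 del_pow1 mul1r divcm1.
by rewrite [mulcm _ _]mul0cm.
Qed.

Lemma wmon_mul_constr u v b : (forall i, del i u = 0) ->
  wmon_mul v b u mone = wmon (u * v) b.
Proof.
move=> du; rewrite wmon_mul_sum (big_fsetD1 mone) /=; last first.
  by rewrite in_fset_set ?inE; [exact: mon_le1 | exact: mon_le_finite].
rewrite big1_fset => [|c]; last first.
  rewrite in_fsetD1 => /andP[/eqP c1 _] _.
  by rewrite (del_pow_const du c1) !mulr0 [LHS]monalgU0.
by rewrite addr0 mon_bin1 del_pow1 mul1r divcm1 [mulcm _ _]mulcm0 mulrC.
Qed.

Lemma weyl_lie_const u f : (forall i, del i u = 0) ->
  weyl_lie (wmon u mone) f = 0.
Proof.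
move=> du; apply/eqP; rewrite subr_eq0; apply/eqP.
have S1 : (wsupp (wmon u mone) `<=` [fset mone])%fset by exact: msuppU_le.
rewrite (weyl_mulEw S1 (fsubset_refl _)) (weyl_mulEw (fsubset_refl _) S1).
rewrite big_seq_fset1; apply: eq_bigr => b _; rewrite big_seq_fset1.
by rewrite wmon_mul_constl wmon_mul_constr // /wcoef mcoeffUU.
Qed.

End WeylAlgebra.

Section WeylBar.
Context (F : fieldType) (A : comAlgType F) (D : set (A -> A)).
Context (hD : spanned_by_commuting_ders D) (I : choiceType) (del : I -> A -> A).

Definition consts_wmon1 : set (weyl A I) := [set wmon u mone | u in consts D].

Definition consts_weyl : set (weyl A I) :=
  [set f | forall a, consts D (wcoef f a)].

Fact consts_wmon1_subspace : subspace consts_wmon1.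
Proof.
split.
  exists 0; last exact: monalgU0.
  move=> d Dd; have := (spanned_derivation hD Dd).1 (-1) 0 0.
  by rewrite scaler0 addr0 scaleN1r addNr.
move=> c _ _ [u cu <-] [v cv <-]; exists (c *: u + v) => [d Dd|].
  by rewrite (spanned_derivation hD Dd).1 cu // cv // scaler0 addr0.
exact: wmonP.
Qed.

Definition weylbar : Type := quotsp consts_wmon1_subspace.
HB.instance Definition _ := GRing.Lmodule.on weylbar.

Definition to_weylbar (f : weyl A I) : weylbar :=
  to_quotsp consts_wmon1_subspace f.

(* The choice of representatives is immaterial by to_weylbar_lie. *)
Definition weylbar_lie (p q : weylbar) : weylbar :=
  to_weylbar (weyl_lie del (repr p) (repr q)).

Lemma to_weylbar_lie (hdel : forall i, D (del i)) f g :
  to_weylbar (weyl_lie del f g) = weylbar_lie (to_weylbar f) (to_weylbar g).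
Proof.
have derdel i : derivation (del i) := spanned_derivation hD (hdel i).
have L f1 f2 h : to_weylbar f1 = to_weylbar f2 ->
    weyl_lie del f1 h = weyl_lie del f2 h.
  move=> /to_quotspP[u cu E]; apply/eqP; rewrite -subr_eq0 -weyl_lieBl // -E.
  by rewrite weyl_lie_const // => i; exact: cu.
have R f1 : to_weylbar (repr (to_weylbar f1)) = to_weylbar f1.
  exact: to_quotsp_repr.
have L' f1 f2 h : to_weylbar f1 = to_weylbar f2 ->
    weyl_lie del h f1 = weyl_lie del h f2.
  move=> /(L _ _ h) E; apply: etrans (weyl_lieN del f1 h) _.
  exact: etrans (congr1 -%R E) (esym (weyl_lieN del f2 h)).
rewrite /weylbar_lie; apply: (congr1 to_weylbar).
transitivity (weyl_lie del (repr (to_weylbar f)) g).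
  exact: (L _ _ g (esym (R f))).
exact: (L' _ _ (repr (to_weylbar f)) (esym (R g))).
Qed.

End WeylBar.

Arguments consts_weyl {F A} D I.
Arguments weylbar {F A D} hD I.
Arguments to_weylbar {F A D} hD {I} f.
Arguments weylbar_lie {F A D} hD {I} del p q.

(* Main.v *)
Require Import Defs.
From mathcomp Require Import all_boot all_algebra finmap.
From mathcomp Require Import boolp classical_sets functions cardinality.
From mathcomp.multinomials Require Import monalg.

Set Implicit Arguments.
Unset Strict Implicit.
Unset Printing Implicit Defensive.

Import GRing.Theory.
Local Open Scope classical_set_scope.
Local Open Scope ring_scope.

(** Write [R] for the algebra A[D] acting on [A] through [theta], and [F1] for
    the constants of [D].

    Sufficiency.  Everything rests on a density statement, [del_pow_dense]: when
    [A] is D-simple and F1[D] acts faithfully, finitely many distinct monomials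
    d^(c) can be given arbitrary values in [A] simultaneously by a single
    combination, \sum_k u_k d^(c)(v_k) = t_c.  Indeed these vectors of values
    form a D-stable A-submodule of a free module [A^X], and a D-stable submodule
    of [A^X] that is not everything is killed by a nonzero linear form with
    constant coefficients ([D_submodule_full]); such a form is exactly a
    nonzero element of F1[D] acting as zero.

    Density has two consequences.  First, [theta] is injective on all of [R], so
    that identities in [R] can be checked on [A].  Second, the brackets [[f, v]]
    with [f] in [R] and [v] in [A] span [R] ([brackets_with_A_span]): in
    [\sum_k [u_k d^(a), v_k]] all the terms of the Leibniz expansion but one
    can be made to vanish.  The surviving binomial coefficient has to be
    nonzero in [F], which is arranged by choosing [a] suitably, in any
    characteristic.

    Let now [N] be a Lie ideal of [R] not contained in [F1].  Bracketing with
    elements of [A] lowers the order of an operator, so [N] contains an element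
    [v] of [A] that is not constant ([lie_ideal_meets_A]); the danger is that
    the last step of the descent lands in [F1] only, which density excludes.
    Since [[u d_i, v] = u d_i(v)], the elements [y] of [A] with [A y] inside [N]
    form a nonzero D-stable ideal, hence [A] is inside [N]
    ([lie_ideal_contains_A]), and [N] contains [[R, A] = R].

    Necessity.  A D-stable ideal [J] of [A] yields the ideal J[D] of [R], and
    the kernel of [theta] is an ideal because [theta] is multiplicative, which
    is the generalized Leibniz rule [del_pow_leibniz].  Simplicity of the
    quotient by [F1] leaves two possibilities for each of them: it lies in [F1],
    or together with [F1] it fills [R].  Comparing with the element [d_i] of [R]
    decides both cases. *)

(** * Monomials and their binomial coefficients *)

Section Monomials.
Context (I : choiceType).
Implicit Types (a b c : {cmonom I}) (i : I).

Lemma cmonom_ext a b : (forall i, a i = b i) -> a = b.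
Proof. by move=> ab; apply/eqP/cmP. Qed.

Lemma mulcmK a b : divcm (mulcm a b) a = b.
Proof. by apply: cmonom_ext => i; rewrite divcmE mulcmE addKn. Qed.

Lemma mulcm_inj a : injective (mulcm a).
Proof. exact: (can_inj (g := fun c => divcm c a) (mulcmK a)). Qed.

Lemma divcmKC a b : mon_le a b -> mulcm a (divcm b a) = b.
Proof. by move=> ab; apply: cmonom_ext => i; rewrite mulcmE divcmE subnKC. Qed.

Lemma mon_le_ucm i a : a i != 0%N -> mon_le (ucm i) a.
Proof. by move=> ai j; rewrite ucmE; case: eqP => [<-|]; rewrite ?lt0n. Qed.

Lemma cmonom_ind (P : {cmonom I} -> Prop) :
  P mone -> (forall i a, P a -> P (mulcm (ucm i) a)) -> forall a, P a.
Proof.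
move=> P1 PS a; have [n] := ubnP (mdeg a); elim: n a => // n IH a.
have [->//|a1] := eqVneq a mone; rewrite ltnS => an.
have [i ai] : exists i, a i != 0%N.
  apply: contrapT => h; case/eqP: a1; apply: cmonom_ext => i; rewrite cm1.
  by apply/eqP/negPn/negP => ai; apply: h; exists i.
have E := divcmKC (mon_le_ucm ai); rewrite -E; apply/PS/IH.
by move: an; rewrite -[in X in X -> _]E [mdeg _](mdegM (ucm i)) mdegU.
Qed.

Definition mdivs a : {fset {cmonom I}} := fset_set [set c | mon_le c a].

Lemma mdivsP a c : reflect (mon_le c a) (c \in mdivs a).
Proof.
rewrite in_fset_set; last exact: mon_le_finite.
by apply: (iffP idP); rewrite inE.
Qed.

Lemma mdivs1 a : mone \in mdivs a.
Proof. exact/mdivsP/mon_le1. Qed.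

Lemma mon_binEw (X : {fset I}) a c : mon_le c a ->
  (finsupp a `<=` X)%fset -> mon_bin a c = (\prod_(i <- X) 'C(a i, c i))%N.
Proof.
move=> ca aX; rewrite /mon_bin (big_fset_incl _ aX) // => i _ ia.
by move: (ca i); rewrite memNfinsupp in ia; rewrite (eqP ia) leqn0 => /eqP ->.
Qed.

(** Unlike [mon_bin], this coefficient vanishes as soon as [c] does not divide
    [a]; sums over divisors may then be extended freely and Pascal's rule
    [mbin_pascal] holds without side condition. *)
Definition mbin a c : nat :=
  (\prod_(i <- (finsupp a `|` finsupp c)%fset) 'C(a i, c i))%N.

Lemma mbinE a c : mon_le c a -> mbin a c = mon_bin a c.
Proof. by move=> ca; rewrite (mon_binEw ca (fsubsetUl _ (finsupp c))). Qed.

Lemma mbin0 a c : ~ mon_le c a -> mbin a c = 0%N.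
Proof.
move=> /existsNP[i /negP]; rewrite -ltnNge => ci.
have iX : i \in (finsupp a `|` finsupp c)%fset.
  by rewrite in_fsetU !mem_finsupp -!lt0n (leq_ltn_trans _ ci) ?orbT.
by rewrite /mbin (big_fsetD1 i iX) /= bin_small.
Qed.

Lemma mbinEw (X : {fset I}) a c :
  (finsupp a `<=` X)%fset -> (finsupp c `<=` X)%fset ->
  mbin a c = (\prod_(i <- X) 'C(a i, c i))%N.
Proof.
move=> aX cX; apply: big_fset_incl => [|i _]; first by rewrite fsubUset aX.
by rewrite in_fsetU negb_or !memNfinsupp => /andP[/eqP -> /eqP ->].
Qed.

Lemma mbin_pascal i a c : mbin (mulcm (ucm i) a) c =
  (mbin a c + (c i != 0) * mbin a (divcm c (ucm i)))%N.
Proof.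
pose X := (i |` (finsupp a `|` finsupp c))%fset.
have iX : i \in X by rewrite !inE eqxx.
have sX b : (forall j, b j != 0 -> [|| j == i, a j != 0 | c j != 0])%N ->
    (finsupp b `<=` X)%fset.
  by move=> h; apply/fsubsetP => j; rewrite !inE !mem_finsupp => /h.
rewrite !(@mbinEw X); try (apply: sX => j; rewrite ?divcmE ?mulcmE ?ucmE).
  rewrite !(big_fsetD1 i iX) /= !mulcmE !divcmE !ucmE eqxx add1n subn1.
  set p1 := (\prod_(_ <- _) _)%N; set p2 := (\prod_(_ <- _) _)%N.
  set p3 := (\prod_(_ <- _) _)%N.
  (* Only the factor at [i] sees the change of [a] or [c]. *)
  have -> : p1 = p2.
    apply: eq_big_seq => j; rewrite in_fsetD1 mulcmE ucmE eq_sym.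
    by case/andP => /negPf ->.
  have -> : p3 = p2.
    apply: eq_big_seq => j; rewrite in_fsetD1 divcmE ucmE eq_sym.
    by case/andP => /negPf ->; rewrite subn0.
  by case: (c i) => [|n]; rewrite ?bin0 ?mul0n ?addn0 // binS mulnDl mul1n.
all: rewrite ?(eq_sym i); case: (eqVneq j i) => //= _.
all: by case: (a j) => [|?]; case: (c j).
Qed.

End Monomials.

(** * Composite derivations and the Leibniz rule *)

Section Operators.
Context (F : fieldType) (A : comAlgType F) (I : choiceType) (del : I -> A -> A).
Hypothesis derdel : forall i, derivation (del i).
Hypothesis delC : forall i j x, del i (del j x) = del j (del i x).
Implicit Types (a b c : {cmonom I}) (u v x y : A) (f g h : weyl A I).

Lemma derivation0 (d : A -> A) : derivation d -> d 0 = 0.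
Proof.
by move=> dd; have := dd.1 (-1) 0 0; rewrite scaler0 addr0 scaleN1r addNr.
Qed.

Lemma derivationD (d : A -> A) : derivation d -> {morph d : x y / x + y}.
Proof. by move=> dd x y; have := dd.1 1 x y; rewrite !scale1r. Qed.

Lemma derivationZ (d : A -> A) : derivation d ->
  forall (k : F) x, d (k *: x) = k *: d x.
Proof. by move=> dd k x; rewrite -[k *: x]addr0 dd.1 derivation0 // addr0. Qed.

Lemma derivation_sum (d : A -> A) : derivation d ->
  forall (T : Type) (s : seq T) (P : pred T) (E : T -> A),
  d (\sum_(t <- s | P t) E t) = \sum_(t <- s | P t) d (E t).
Proof.
by move=> dd T s P E; apply: big_morph; [exact: derivationD|exact: derivation0].
Qed.

Lemma derivation1 (d : A -> A) : derivation d -> d 1 = 0.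
Proof.
by move=> dd; have := dd.2 1 1; rewrite !mulr1 mul1r -{1}[d 1]addr0 => /addrI.
Qed.

Lemma derivation_nat (d : A -> A) : derivation d ->
  forall n x, d (n%:R * x) = n%:R * d x.
Proof.
move=> dd n x; rewrite !mulr_natl; elim: n => [|n IH].
  by rewrite !mulr0n derivation0.
by rewrite !mulrS derivationD // IH.
Qed.

(** [del_pow] composes along the list [finsupp a], which changes with [a].
    Composing along any duplicate-free list of indices that contains the support
    of the exponent gives the same result, which makes two monomials comparable
    along a common list. *)
Let pow_along (s : seq I) (f : I -> nat) x :=
  foldr (fun j => iter (f j) (del j)) x s.

Lemma iter_delC n i m j x :
  iter n (del i) (iter m (del j) x) = iter m (del j) (iter n (del i) x).
Proof.
have C1 k y : iter k (del i) (del j y) = del j (iter k (del i) y).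
  by elim: k => //= k ->.
by elim: m => //= m <-.
Qed.

Let pow_along_rem s (f : I -> nat) i x : i \in s ->
  pow_along s f x = iter (f i) (del i) (pow_along (rem i s) f x).
Proof.
elim: s => //= j s IH; rewrite inE; case: eqVneq => [->|ij] //= is_.
by rewrite IH // iter_delC.
Qed.

Let pow_along_eq s t (f g : I -> nat) x : uniq s -> uniq t -> f =1 g ->
  (forall j, f j != 0%N -> (j \in s) = (j \in t)) ->
  pow_along s f x = pow_along t g x.
Proof.
move=> us ut fg; elim: s t us ut => [|i s IH] t /=.
  move=> _ _ h; suff: forall j, j \in t -> g j = 0%N.
    elim: t {h} => //= j t IHt h; rewrite h ?mem_head //=.
    by apply: IHt => k kt; apply: h; rewrite inE kt orbT.
  by move=> j jt; rewrite -fg; apply/eqP; apply: contraTT jt => /h <-.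
move=> /andP[is_ us] ut h; have [fi|fi] := eqVneq (f i) 0%N.
  rewrite fi /=; apply: IH => // j fj; rewrite -h // inE.
  by case: (eqVneq j i) fj => // ->; rewrite fi.
have it : i \in t by rewrite -h // mem_head.
rewrite (pow_along_rem g x it) -fg (IH (rem i t)) ?rem_uniq // => j fj.
rewrite mem_rem_uniq // inE -h // !inE /=; case: (eqVneq j i) => //= ->.
exact: negbTE.
Qed.

Let del_powE a x : del_pow del a x = pow_along (finsupp a) a x.
Proof.
rewrite /del_pow; elim: (finsupp a : seq I) => [|i s IH].
  by rewrite big_nil.
by rewrite big_cons /= IH.
Qed.

Lemma del_pow_ucm i a x :
  del_pow del (mulcm (ucm i) a) x = del i (del_pow del a x).
Proof.
pose X := (i |` finsupp a)%fset.
have E b : (forall j, b j != 0 -> (j == i) || (a j != 0))%N ->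
    del_pow del b x = pow_along X b x.
  move=> h; rewrite del_powE; apply: pow_along_eq => // j bj.
  by rewrite mem_finsupp bj !inE mem_finsupp h.
rewrite (E a) => [|j ->]; last by rewrite orbT.
rewrite E => [|j]; last by rewrite mulcmE ucmE (eq_sym i); case: (eqVneq j i).
have iX : i \in (X : seq I) by rewrite [_ \in _](fset1U1 i).
rewrite !(pow_along_rem _ _ iX) mulcmE ucmE eqxx /=; congr (del i (iter _ _ _)).
have : uniq (X : seq I) by exact: fset_uniq.
move=> /(mem_rem_uniq) /(_ i) m; have : i \notin rem i X by rewrite m !inE eqxx.
elim: (rem i X) => //= j s IH; rewrite inE negb_or => /andP[ij is_].
by rewrite IH // mulcmE ucmE (negPf ij).
Qed.

Lemma del_pow_mul a b x :
  del_pow del (mulcm a b) x = del_pow del a (del_pow del b x).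
Proof.
elim/cmonom_ind: a => [|i a IH].
  by rewrite [mulcm _ _]mul0cm del_pow1.
by rewrite -mulcmA !del_pow_ucm IH.
Qed.

Lemma del_pow_comm (d : A -> A) a x : (forall i y, d (del i y) = del i (d y)) ->
  d (del_pow del a x) = del_pow del a (d x).
Proof.
move=> dC; elim/cmonom_ind: a => [|i a IH]; first by rewrite !del_pow1.
by rewrite !del_pow_ucm dC IH.
Qed.

Lemma del_powD a : {morph del_pow del a : x y / x + y}.
Proof.
elim/cmonom_ind: a => [|i a IH] x y; first by rewrite !del_pow1.
by rewrite !del_pow_ucm IH derivationD.
Qed.

Lemma del_pow0 a : del_pow del a 0 = 0.
Proof.
elim/cmonom_ind: a => [|i a IH]; first by rewrite del_pow1.
by rewrite del_pow_ucm IH derivation0.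
Qed.

Lemma del_pow_sum a (T : Type) (s : seq T) (E : T -> A) :
  del_pow del a (\sum_(t <- s) E t) = \sum_(t <- s) del_pow del a (E t).
Proof. by apply: big_morph; [exact: del_powD|exact: del_pow0]. Qed.

(** Induction on [a]: applying one more derivation [del i] splits every term in
    two, according to the factor that [del i] hits, and the two families are
    those of Pascal's rule. *)
Lemma del_pow_leibniz a x y : del_pow del a (x * y) =
  \sum_(c <- mdivs a)
     (mon_bin a c)%:R * (del_pow del c x * del_pow del (divcm a c) y).
Proof.
pose dp := del_pow del.
suff -> : del_pow del a (x * y) = \sum_(c <- mdivs a)
     (mbin a c)%:R * (dp c x * dp (divcm a c) y).
  by apply: eq_big_seq => c /mdivsP ca; rewrite mbinE.
elim/cmonom_ind: a => [|i a IH].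
  rewrite /mdivs (_ : [set c | _] = [set mone]); last first.
    apply/seteqP; split=> c /= => [c1|->]; last exact: mon_le_refl.
    by apply/eqP/cmP => i; have := c1 i; rewrite !cm1 leqn0 => /eqP.
  rewrite fset_set1 big_seq_fset1 mbinE; last exact: mon_le_refl.
  by rewrite mon_bin1 divcm1 /dp !del_pow1 mul1r.
rewrite del_pow_ucm IH derivation_sum //.
under eq_bigr do
  rewrite derivation_nat // (derdel i).2 mulrDr -!del_pow_ucm -!/dp.
under [RHS]eq_bigr do rewrite mbin_pascal natrD mulrDl.
rewrite !big_split /= addrC; congr (_ + _).
  (* Terms where [del i] hits [y]: the divisor [c] is unchanged. *)
  have sub : (mdivs a `<=` mdivs (mulcm (ucm i) a))%fset.
    apply/fsubsetP => c /mdivsP ca; apply/mdivsP => j.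
    by rewrite mulcmE (leq_trans (ca j)) // leq_addl.
  rewrite -(big_fset_incl _ sub) => [|c _ /mdivsP ca]; last first.
    by rewrite mbin0 // mul0r.
  apply: eq_big_seq => c /mdivsP ca; congr (_ * (_ * dp _ _)).
  by apply: cmonom_ext => j; rewrite !(mulcmE, divcmE) addnBA.
(* Terms where [del i] hits [x]: the divisor [c] becomes [c] times [del i]. *)
have sub : ([fset mulcm (ucm i) c | c in mdivs a] `<=`
    mdivs (mulcm (ucm i) a))%fset.
  apply/fsubsetP => _ /imfsetP[c /= /mdivsP ca ->]; apply/mdivsP => j.
  by rewrite !mulcmE leq_add2l.
rewrite -(big_fset_incl _ sub) => [|c _ cn]; last first.
  have [/= _|ci] := eqVneq (c i) 0%N; first by rewrite mul0n mul0r.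
  rewrite mbin0 ?muln0 ?mul0r // => ca; case/negP: cn.
  apply/imfsetP; exists (divcm c (ucm i)); first exact/mdivsP.
  by rewrite divcmKC //; exact: mon_le_ucm.
rewrite big_imfset /=; last by move=> b c _ _; exact: mulcm_inj.
apply: eq_bigr => c _; rewrite mulcmK mulcmE ucmE eqxx mul1n.
congr (_ * (_ * dp _ _)).
by apply: cmonom_ext => j; rewrite !(mulcmE, divcmE) subnDl.
Qed.

End Operators.

(** * The action of the Weyl algebra *)

Section Theta.
Context (F : fieldType) (A : comAlgType F) (I : choiceType) (del : I -> A -> A).
Hypothesis derdel : forall i, derivation (del i).
Hypothesis delC : forall i j x, del i (del j x) = del j (del i x).
Implicit Types (a b c : {cmonom I}) (u v x y : A) (f g h : weyl A I).

Lemma wcoef0 a : wcoef (0 : weyl A I) a = 0.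
Proof. exact: mcoeff0. Qed.

Lemma wcoef_sum (T : Type) (s : seq T) (E : T -> weyl A I) a :
  wcoef (\sum_(t <- s) E t) a = \sum_(t <- s) wcoef (E t) a.
Proof. by apply: big_morph => [f g|]; [exact: wcoefD|exact: wcoef0]. Qed.

Lemma wsuppP f a : reflect (wcoef f a <> 0) (a \in wsupp f).
Proof. by rewrite -mcoeff_neq0; exact: (negPP eqP). Qed.

Lemma wcoef_out f a : a \notin wsupp f -> wcoef f a = 0.
Proof. exact: mcoeff_outdom. Qed.

Lemma weyl_sum_mon f : f = \sum_(a <- wsupp f) wmon (wcoef f a) a.
Proof. exact: monalgE. Qed.

Lemma thetaEw (X : {fset {cmonom I}}) f x : (wsupp f `<=` X)%fset ->
  theta del f x = \sum_(a <- X) wcoef f a * del_pow del a x.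
Proof.
move=> fX; apply: big_fset_incl => // a _ /wcoef_out ->.
by rewrite mul0r.
Qed.

Lemma theta0 x : theta del 0 x = 0.
Proof.
rewrite (@thetaEw fset0) ?big_seq_fset0 //.
by apply/fsubsetP => a /wsuppP; rewrite wcoef0.
Qed.

Lemma thetaD f g x : theta del (f + g) x = theta del f x + theta del g x.
Proof.
pose X := (wsupp f `|` wsupp g)%fset.
rewrite !(@thetaEw X) ?fsubsetUl ?fsubsetUr //; last exact: msuppD_le.
by rewrite -big_split; apply: eq_bigr => a _ /=; rewrite wcoefD mulrDl.
Qed.

Lemma theta_sum (T : Type) (s : seq T) (E : T -> weyl A I) x :
  theta del (\sum_(t <- s) E t) x = \sum_(t <- s) theta del (E t) x.
Proof.
by apply: (big_morph (fun f => theta del f x)) => [f g|];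
  [exact: thetaD|exact: theta0].
Qed.

Lemma theta_mon u a x : theta del (wmon u a) x = u * del_pow del a x.
Proof.
rewrite (@thetaEw [fset a]%fset) ?big_seq_fset1 ?wcoef_mon ?eqxx //.
exact: msuppU_le.
Qed.

Lemma theta_wmon_mul u a v b x : theta del (wmon_mul del u a v b) x =
  u * del_pow del a (v * del_pow del b x).
Proof.
rewrite wmon_mul_sum theta_sum (del_pow_leibniz derdel delC) mulr_sumr.
apply: eq_big_seq => c /mdivsP ca; rewrite theta_mon -!mulrA.
congr (_ * (_ * (_ * _))).
rewrite -del_pow_mul //; congr (del_pow del _ x).
by apply: cmonom_ext => i; rewrite !(mulcmE, divcmE) addnBAC.
Qed.

Lemma theta_mul f g x :
  theta del (weyl_mul del f g) x = theta del f (theta del g x).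
Proof.
rewrite /weyl_mul theta_sum; apply: eq_bigr => a _.
rewrite theta_sum [in RHS]/theta (del_pow_sum derdel delC) mulr_sumr.
by apply: eq_bigr => b _; rewrite theta_wmon_mul.
Qed.

Lemma theta_r0 f : theta del f 0 = 0.
Proof.
by rewrite /theta big1 // => a _; rewrite (del_pow0 derdel delC) mulr0.
Qed.

Lemma thetaN f x : theta del (- f) x = - theta del f x.
Proof. by apply/eqP; rewrite -addr_eq0 -thetaD addNr theta0. Qed.

Lemma theta_lie f g x : theta del (weyl_lie del f g) x =
  theta del f (theta del g x) - theta del g (theta del f x).
Proof. by rewrite /weyl_lie thetaD thetaN; congr (_ - _); exact: theta_mul. Qed.

Lemma thetaZ (k : F) f x : theta del (k *: f) x = k *: theta del f x.
Proof.
rewrite (@thetaEw (wsupp f)) => [|]; last first.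
  apply/fsubsetP => a /wsuppP; rewrite wcoefZ => h; apply/wsuppP => f0.
  by apply: h; rewrite f0 scaler0.
by rewrite scaler_sumr; apply: eq_bigr => a _; rewrite wcoefZ scalerAl.
Qed.

(** Every monomial on the right properly divides a monomial of [f]: bracketing
    with an element of [A] lowers the order. *)
Lemma weyl_lie_mon1r f v : weyl_lie del f (wmon v mone) =
  \sum_(a <- wsupp f) \sum_(c <- (mdivs a `\ mone)%fset)
    wmon (wcoef f a * ((mon_bin a c)%:R * del_pow del c v)) (divcm a c).
Proof.
have S1 : (wsupp (wmon v mone) `<=` [fset (mone : {cmonom I})])%fset.
  exact: msuppU_le.
rewrite /weyl_lie (weyl_mulEw derdel (fsubset_refl _) S1).
rewrite (weyl_mulEw derdel S1 (fsubset_refl _)) big_seq_fset1 -sumrB.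
apply: eq_bigr => a _; rewrite big_seq_fset1 wcoef_mon eqxx mulr1n.
rewrite wmon_mul_constl wmon_mul_sum (big_fsetD1 mone) /=; last exact: mdivs1.
rewrite [mulcm a _](mulcm0 a) mon_bin1 divcm1 del_pow1 mul1r [v * _]mulrC.
by rewrite [LHS]addrC addKr.
Qed.

Lemma theta_const u x : theta del (wmon u mone) x = u * x.
Proof. by rewrite theta_mon del_pow1. Qed.

Lemma theta_lie_const f v x : theta del (weyl_lie del f (wmon v mone)) x =
  theta del f (v * x) - v * theta del f x.
Proof.
by rewrite theta_lie (theta_const v x) (theta_const v (theta del f x)).
Qed.

(** The term of trivial divisor in the Leibniz expansion is cancelled by the
    commutation with [v]; only derivatives of [v] of positive order are left. *)
Lemma theta_lie_mon u a v x :
  theta del (weyl_lie del (wmon u a) (wmon v mone)) x =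
  \sum_(c <- (mdivs a `\ mone)%fset)
    (mon_bin a c)%:R * (u * del_pow del c v * del_pow del (divcm a c) x).
Proof.
rewrite theta_lie_const (theta_mon u a (v * x)) (theta_mon u a x).
rewrite (del_pow_leibniz derdel delC) (big_fsetD1 mone) /=; last exact: mdivs1.
rewrite mon_bin1 mul1r divcm1 del_pow1 mulrDr [v * (u * _)]mulrCA.
rewrite [X in X - _]addrC addrK mulr_sumr.
by apply: eq_bigr => c _; rewrite mulrCA -!mulrA.
Qed.

End Theta.

(** * Subspaces, and derivations in the span of a basis *)

Lemma subspaceD (F : fieldType) (V : lmodType F) (N : set V) :
  subspace N -> forall x y, N x -> N y -> N (x + y).
Proof. by move=> [_ ND] x y Nx Ny; rewrite -[x]scale1r; exact: ND. Qed.

Lemma subspaceZ (F : fieldType) (V : lmodType F) (N : set V) :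
  subspace N -> forall (k : F) x, N x -> N (k *: x).
Proof. by move=> [N0 ND] k x Nx; rewrite -[_ *: _]addr0; exact: ND. Qed.

Lemma subspace_sum (F : fieldType) (V : lmodType F) (N : set V)
    (T : eqType) (s : seq T) (E : T -> V) :
  subspace N -> (forall t, t \in s -> N (E t)) -> N (\sum_(t <- s) E t).
Proof.
move=> sN NE; rewrite big_seq; apply: (big_ind N) => //; first by case: sN.
exact: subspaceD.
Qed.

Section CommutingDerivations.
Context (F : fieldType) (A : comAlgType F) (D : set (A -> A)).
Context (hD : spanned_by_commuting_ders D) (I : choiceType) (del : I -> A -> A).
Hypothesis hdel : is_basis D del.
Implicit Types (a b c : {cmonom I}) (u v x y : A) (f g h : weyl A I).
Implicit Types (d : A -> A).

Lemma basis_in_D i : D (del i).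
Proof.
have [_ ->] := hdel; exists 1%N, (fun=> 1), (fun=> del i).
split; first by exists i.
by rewrite big_ord1 scale1r.
Qed.

Let derdel i : derivation (del i) := spanned_derivation hD (basis_in_D i).

Lemma der_combE n (k : 'I_n -> F) (w : 'I_n -> A -> A) x :
  (\sum_(j < n) k j *: w j) x = \sum_(j < n) k j *: w j x.
Proof. by rewrite fct_sumE. Qed.

Lemma span_commute d e x : D d -> D e -> d (e x) = e (d x).
Proof.
have [S [derS SC ->]] := hD => - [n [k [w [Sw ->]]]] [m [l [z [Sz ->]]]].
rewrite !der_combE.
under eq_bigr do rewrite (derivation_sum (derS _ (Sw _))) scaler_sumr.
rewrite exchange_big /=; apply: eq_bigr => j _.
rewrite (derivation_sum (derS _ (Sz _))) scaler_sumr; apply: eq_bigr => t _.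
rewrite (derivationZ (derS _ (Sw _))) (derivationZ (derS _ (Sz _))) !scalerA.
rewrite mulrC; congr (_ *: _).
exact: (congr1 (fun r : A -> A => r x) (SC _ _ (Sw t) (Sz j))).
Qed.

Let delC i j x : del i (del j x) = del j (del i x).
Proof. exact: (span_commute x (basis_in_D i) (basis_in_D j)). Qed.

Lemma basis_span d x (P : set A) : D d -> subspace P ->
  (forall i, P (del i x)) -> P (d x).
Proof.
have [_ ->] := hdel => - [n [k [w [rw ->]]]] sP Pd; rewrite der_combE.
apply: subspace_sum => // j _; apply: subspaceZ => //.
by have [i _ <-] := rw j; exact: Pd.
Qed.

Lemma subspace0 : subspace [set 0 : A].
Proof. by split=> // k x y -> ->; rewrite scaler0 addr0. Qed.

Lemma constsP u : consts D u <-> forall i, del i u = 0.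
Proof.
split=> [cu i|h d Dd]; first exact/cu/basis_in_D.
exact: (basis_span Dd subspace0).
Qed.

Local Notation W := (@consts_wmon1 F A D I).

(** * Necessity *)

Lemma to_weylbar0 : to_weylbar hD (0 : weyl A I) = 0.
Proof.
set q := to_weylbar hD _; apply: (addrI q); rewrite addr0.
by rewrite -[RHS](congr1 (to_weylbar hD) (addr0 0)) [RHS]to_quotspD.
Qed.

(** Ideals of [weyl] are easier to build than ideals of the quotient; the image
    of [K] in the quotient is an ideal. *)
Lemma lie_simple_weyl_ideal (K : set (weyl A I)) :
  lie_simple (weylbar_lie hD del) -> lie_ideal (weyl_lie del) K ->
  (K `<=` W) \/ (forall f, exists2 k, K k & W (f - k)).
Proof.
move=> [_ simp] [[K0 KD] Kl]; pose pi := @to_weylbar F A D hD I : weyl A I -> _.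
have piK q : pi (repr q) = q by exact: to_quotsp_repr.
have [] := simp (pi @` K).
- split.
    split; first by exists 0; rewrite ?[pi 0]to_weylbar0.
    move=> k _ _ [f Kf <-] [g Kg <-]; exists (k *: f + g); first exact: KD.
    by rewrite /pi /to_weylbar to_quotspD to_quotspZ.
  move=> q _ [f Kf <-]; rewrite -(piK q); have [K1 K2] := Kl (repr q) f Kf.
  by rewrite -!to_weylbar_lie; [split; [exists (weyl_lie del (repr q) f)|
     exists (weyl_lie del f (repr q))] | exact: basis_in_D..].
- move=> E; left=> f Kf; have : (pi @` K) (pi f) by exists f.
  by rewrite E /= -to_weylbar0 => /to_quotspP; rewrite subr0.
- move=> E; right=> f; have : (pi @` K) (pi f) by rewrite E.
  by move=> [k Kk /esym /to_quotspP Wfk]; exists k.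
Qed.


Lemma const_coef w a : W w -> a <> mone -> wcoef w a = 0.
Proof.
by move=> [u _ <-] /eqP a1; rewrite wcoef_mon eq_sym (negPf a1) mulr0n.
Qed.

Lemma ucm_neq1 i : ucm i <> mone :> {cmonom I}.
Proof. by move=> /(congr1 (fun a : {cmonom I} => a i)); rewrite cm1 cmUU. Qed.

(** A D-stable ideal [J] gives the two-sided ideal J[D].  If it consists of
    constants, then [x d_i] is a constant for all [x] in [J], so [J = 0]; if it
    fills the algebra modulo constants, the coefficient 1 of [d_i] is in [J]. *)
Lemma lie_simple_D_simple (i : I) :
  lie_simple (weylbar_lie hD del) -> D_simple D.
Proof.
move=> simp J J0 JD JM Jd.
have Jsum (T : eqType) (s : seq T) (E : T -> A) :
    (forall t, t \in s -> J (E t)) -> J (\sum_(t <- s) E t).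
  by move=> h; rewrite big_seq; apply: (big_ind J).
have Jpow a x : J x -> J (del_pow del a x).
  elim/cmonom_ind: a => [|j a IH] Jx; first by rewrite del_pow1.
  by rewrite del_pow_ucm //; apply: Jd; [exact: basis_in_D|exact: IH].
pose K : set (weyl A I) := [set f | forall a, J (wcoef f a)].
have Kmon x a : J x -> K (wmon x a).
  by move=> Jx b; rewrite wcoef_mon; case: eqP.
have KD f g : K f -> K g -> K (f + g).
  by move=> Kf Kg a; rewrite wcoefD; exact: JD.
have K0 : K 0 by move=> a; rewrite wcoef0.
have Ksum (T : eqType) (s : seq T) (E : T -> weyl A I) :
    (forall t, t \in s -> K (E t)) -> K (\sum_(t <- s) E t).
  by move=> h; rewrite big_seq; apply: (big_ind K).
have KZ (k : F) f : K f -> K (k *: f).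
  by move=> Kf a; rewrite wcoefZ -[wcoef f a]mul1r scalerAl; exact: JM.
have KN f : K f -> K (- f) by rewrite -scaleN1r; exact: KZ.
have Kmul f g : K f \/ K g -> K (weyl_mul del f g).
  move=> Kfg; apply: (Ksum) => a _; apply: (Ksum) => b _; rewrite wmon_mul_sum.
  apply: (Ksum) => c _; apply: Kmon; case: Kfg => [Kf|Kg].
    by rewrite mulrC; exact: JM.
  by apply/JM/JM/Jpow.
have [|KW|KR] := @lie_simple_weyl_ideal K simp.
- split=> [|f g Kg].
    by split=> // k f g Kf Kg; apply: KD => //; exact: KZ.
  have Kl := Kmul _ f (or_introl Kg); have Kr := Kmul f _ (or_intror Kg).
  by split; apply: KD => //; exact: KN.
- left; apply/seteqP; split=> x /= => [Jx|->] //.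
  have := const_coef (KW _ (Kmon x (ucm i) Jx)) (@ucm_neq1 i).
  by rewrite wcoef_mon eqxx.
- right; apply/seteqP; split=> // x _; rewrite -[x]mulr1; apply: (JM).
  have [k Kk Wk] := KR (wmon 1 (ucm i)).
  have := const_coef Wk (@ucm_neq1 i).
  rewrite -[_ - k]/(_ + - k) wcoefD wcoef_mon eqxx mulr1n => /eqP.
  rewrite addr_eq0 => /eqP ->; rewrite -mulN1r.
  exact: (JM _ _ (KN _ Kk _)).
Qed.

(** The kernel of [theta] contains no nonzero constant [u], as [u] maps 1 to
    itself.  If the kernel filled the algebra modulo constants, [del i] would be
    the multiplication by some [u]; but [del i] kills 1, so [u = 0]. *)
Lemma lie_simple_faithful (i : I) : del i <> 0 ->
  lie_simple (weylbar_lie hD del) -> forall f, theta del f = 0 -> f = 0.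
Proof.
move=> di0 simp.
have [|KW|KR] := @lie_simple_weyl_ideal [set f | theta del f = 0] simp.
- split.
    split=> [|k f g /= f0 g0]; first by apply/funext => x; rewrite theta0.
    by apply/funext => x; rewrite thetaD thetaZ f0 g0 addr0 scaler0.
  move=> f g /= g0; have lie0 p q : theta del p = 0 \/ theta del q = 0 ->
      theta del (weyl_lie del p q) = 0.
    have th0 r y : theta del r = 0 -> theta del r y = 0 by move=> ->.
    move=> pq; apply/funext => x; rewrite theta_lie //.
    by case: pq => /th0 E; rewrite !E (theta_r0 derdel delC) subrr.
  by split; apply: lie0; [right|left].
- move=> f f0; have [u _ uf] := KW _ f0; rewrite -uf.
  suff -> : u = 0 by exact: monalgU0.
  have := congr1 (fun r : A -> A => r 1) f0.
  by rewrite /= -uf theta_const mulr1.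
- case: di0; apply/funext => x.
  have [k k0 [u _ uk]] := KR (wmon 1 (ucm i)).
  have E y : u * y = del i y.
    have := theta_const del u y; rewrite uk thetaD thetaN k0 subr0 => <-.
    by rewrite theta_mon // mul1r -[ucm i]mulcm0 del_pow_ucm // del_pow1.
  by rewrite -E -[u]mulr1 E derivation1 ?mul0r.
Qed.

End CommutingDerivations.

(** * Density *)

Section Density.
Context (F : fieldType) (A : comAlgType F) (D : set (A -> A)).
Hypothesis derD : forall d, D d -> derivation d.
Hypothesis simpD : D_simple D.

(** Induction on [X].  By induction [M] surjects onto the values at [X]; let [J]
    be the D-stable ideal of the values at the new point [x0] of the elements of
    [M] that vanish on [X].  If [J = A] the values at [x0] can be corrected at
    will.  If [J = 0], an element of [M] is determined at [x0] by its values on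
    [X]: with [e y] in [M] equal to the indicator of [y] on [X], the value at
    [x0] is the combination of the values on [X] with coefficients [e y x0].
    These are constants: [d] of [e y] vanishes on [X], so its value at [x0] is
    in [J].  Hence [M] is killed by a linear form with constant coefficients,
    and coefficient -1 at [x0]. *)
Lemma D_submodule_full (T : eqType) (M : set (T -> A)) (X : seq T) :
  uniq X -> M (fun=> 0) -> (forall m n, M m -> M n -> M (fun x => m x + n x)) ->
  (forall a m, M m -> M (fun x => a * m x)) ->
  (forall d m, D d -> M m -> M (fun x => d (m x))) ->
  (forall c : T -> A, (forall x, x \in X -> consts D (c x)) ->
     (forall m, M m -> \sum_(x <- X) c x * m x = 0) ->
     forall x, x \in X -> c x = 0) ->
  forall t : T -> A, exists2 m, M m & forall x, x \in X -> m x = t x.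
Proof.
move=> uX M0 MD MZ Md; elim: X uX => [|x0 X IH] /=.
  by move=> _ _ t; exists (fun=> 0).
move=> /andP[x0X uX] nokill.
have neq x : x \in X -> (x == x0) = false.
  by move=> xX; apply: contraNF x0X => /eqP <-.
have fullX : forall t : T -> A, exists2 m, M m & forall x, x \in X -> m x = t x.
  apply: IH => // c cF ck x xX.
  have := nokill (fun y => if y == x0 then 0 else c y).
  move=> /(_ _ _ x); rewrite neq // inE xX orbT; apply=> // [y|m Mm].
    rewrite inE; case: eqP => [_ _ d Dd|_ /cF //].
    exact/derivation0/derD.
  rewrite big_cons eqxx mul0r add0r -[RHS](ck m Mm).
  by apply: eq_big_seq => y yX; rewrite neq.
pose J : set A :=
  [set y | exists m, [/\ M m, forall x, x \in X -> m x = 0 & m x0 = y]].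
have [||||J0|JT] := simpD (J := J).
- by exists (fun=> 0).
- move=> _ _ [m [Mm m0 <-]] [n [Mn n0 <-]]; exists (fun x => m x + n x).
  by split=> [||//]; [exact: MD|move=> x xX; rewrite m0 // n0 // addr0].
- move=> a _ [m [Mm m0 <-]]; exists (fun x => a * m x).
  by split=> [||//]; [exact: MZ|move=> x xX; rewrite m0 // mulr0].
- move=> d _ Dd [m [Mm m0 <-]]; exists (fun x => d (m x)).
  split=> [||//]; first exact: Md.
  by move=> x xX; rewrite m0 // (derivation0 (derD Dd)).
- have /choice[e He] y : exists ey : T -> A,
      M ey /\ forall x, x \in X -> ey x = (x == y)%:R.
    by have [m Mm mt] := fullX (fun x => (x == y)%:R); exists m.
  have ec y : consts D (e y x0).
    move=> d Dd; have : J (d (e y x0)).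
      exists (fun x => d (e y x)); split=> //; first exact/Md/(He y).1.
      move=> x xX; rewrite (He y).2 //; have dd := derD Dd.
      by case: eqP => _; [exact: derivation1|exact: derivation0].
    by rewrite J0.
  have := nokill (fun y => if y == x0 then -1 else e y x0).
  move=> /(_ _ _ x0); rewrite eqxx mem_head => h.
  suff /eqP : -1 = 0 :> A by rewrite oppr_eq0 oner_eq0.
  apply: h => // [y _|m Mm].
    case: eqP => // _ d Dd; have dd := derD Dd.
    by rewrite -scaleN1r derivationZ // derivation1 // scaler0.
  rewrite big_cons eqxx mulN1r addrC; apply/eqP; rewrite subr_eq0; apply/eqP.
  rewrite (eq_big_seq (fun y => m y * e y x0)) => [|y yX]; last first.
    by rewrite neq // mulrC.
  pose r x := \sum_(y <- X) m y * e y x.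
  have Mr : M r.
    rewrite /r; elim: (X : seq T) => [|y s IHs].
      rewrite (_ : (fun _ => _) = fun=> 0) //.
      by apply/funext => x; rewrite big_nil.
    rewrite (_ : (fun _ => _) =
        fun x => m y * e y x + \sum_(z <- s) m z * e z x).
      by apply: (MD) => //; apply: (MZ); exact: (He y).1.
    by apply/funext => x; rewrite big_cons.
  have : J (r x0 + -1 * m x0).
    exists (fun x => r x + -1 * m x); split=> //.
      by apply: (MD) => //; exact: MZ.
    move=> x xX; rewrite /r (bigD1_seq x) //= big_seq_cond.
    rewrite big1 => [|y /andP[yX yx]].
      by rewrite (He x).2 // eqxx mulr1 addr0 mulN1r subrr.
    by rewrite (He y).2 // eq_sym (negPf yx) mulr0.
  by rewrite J0 /= mulN1r => /eqP; rewrite subr_eq0 => /eqP.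
- move=> t; have [m Mm mt] := fullX t.
  have [n [Mn n0 nx]] : J (t x0 - m x0) by rewrite JT.
  exists (fun x => m x + n x) => [|x]; first exact: MD.
  rewrite inE; case: eqP => [-> _|_ /= xX]; first by rewrite nx subrKC.
  by rewrite n0 // addr0 mt.
Qed.

End Density.

(** * Sufficiency *)

(** Otherwise ['C(n + b, n)] would vanish in [F] for all large [n]; then by
    Pascal's rule so would ['C(n + b.-1, n)], and finally ['C(n, n) = 1]. *)
Lemma bin_neq0 (F : fieldType) (b m : nat) :
  exists2 n, (m <= n)%N & 'C(n + b, n)%:R != 0 :> F.
Proof.
elim: b m => [|b IH] m; first by exists m; rewrite // addn0 binn oner_eq0.
apply: contrapT => h.
have z n : (m <= n)%N -> 'C(n + b.+1, n)%:R = 0 :> F.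
  by move=> mn; apply/eqP/negPn/negP => nz; apply: h; exists n.
have [n mn] := IH m.+1; case: n mn => // n mn /eqP; apply.
by have := z n.+1 (ltnW mn); rewrite addSn binS natrD z // addr0 addnS -addSn.
Qed.

Section Sufficiency.
Context (F : fieldType) (A : comAlgType F) (D : set (A -> A)).
Context (hD : spanned_by_commuting_ders D) (I : choiceType) (del : I -> A -> A).
Hypothesis hdel : is_basis D del.
Hypothesis simpD : D_simple D.
Hypothesis faithful : acts_faithfully del (consts_weyl D I).
Implicit Types (a b c : {cmonom I}) (u v x y : A) (f g h : weyl A I).
Implicit Types (d : A -> A).

Let derdel i : derivation (del i) :=
  spanned_derivation hD (basis_in_D hdel i).

Let delC i j x : del i (del j x) = del j (del i x).
Proof. exact: (span_commute hD x (basis_in_D hdel i) (basis_in_D hdel j)). Qed.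

(** A linear form with constant coefficients that kills the vectors of values
    d^(c)(v) is an element of F1[D] acting as zero. *)
Lemma del_pow_dense (X : seq {cmonom I}) (t : {cmonom I} -> A) : uniq X ->
  exists s : seq (A * A), forall c, c \in X ->
    \sum_(p <- s) p.1 * del_pow del c p.2 = t c.
Proof.
move=> uX; pose M : set ({cmonom I} -> A) := [set m | exists s : seq (A * A),
  m = fun c => \sum_(p <- s) p.1 * del_pow del c p.2].
have [m [s ->] mt] : exists2 m, M m & forall c, c \in X -> m c = t c;
  last first.
  by exists s.
apply: (D_submodule_full (fun d => spanned_derivation hD) simpD uX).
- by exists [::]; apply/funext => c; rewrite big_nil.
- move=> _ _ [s ->] [r ->]; exists (s ++ r).
  by apply/funext => c; rewrite big_cat.
- move=> a _ [s ->]; exists [seq (a * p.1, p.2) | p <- s].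
  apply/funext => c; rewrite big_map mulr_sumr.
  by apply: eq_bigr => p _; rewrite mulrA.
- move=> d _ Dd [s ->]; have dd := spanned_derivation hD Dd.
  exists ([seq (d p.1, p.2) | p <- s] ++ [seq (p.1, d p.2) | p <- s]).
  apply/funext => c; rewrite big_cat /= !big_map -big_split derivation_sum //=.
  apply: eq_bigr => p _; rewrite dd.2 (del_pow_comm delC (d := d)) // => i y.
  by rewrite (span_commute hD y Dd (basis_in_D hdel i)).
- move=> k kF k0 c cX; pose f : weyl A I := \sum_(b <- X) wmon (k b) b.
  have fk b : wcoef f b = \sum_(c <- X) k c *+ (c == b).
    by rewrite wcoef_sum; apply: eq_bigr => b' _; rewrite wcoef_mon.
  have f0 : f = 0.
    apply: faithful => [b d Dd|b d Dd|].
    - rewrite fk derivation_sum; last exact: (spanned_derivation hD Dd).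
      rewrite big_seq big1 // => b' b'X; case: eqP => _.
        by rewrite mulr1n; exact: kF.
      by rewrite mulr0n (derivation0 (spanned_derivation hD Dd)).
    - by rewrite wcoef0 (derivation0 (spanned_derivation hD Dd)).
    apply/funext => x; rewrite theta0 theta_sum.
    have Mx : M (fun c => \sum_(p <- [:: (1, x)]) p.1 * del_pow del c p.2).
      by exists [:: (1, x)].
    rewrite -[RHS](k0 _ Mx).
    by apply: eq_bigr => b _; rewrite theta_mon // big_seq1 mul1r.
  have := fk c; rewrite f0 wcoef0 (bigD1_seq c) //= eqxx mulr1n.
  by rewrite big1 ?addr0 // => b /negPf ->.
Qed.

(** Density isolates each coefficient of [f]: choose [s] so that
    [\sum_k u_k d^(c)(v_k)] is the indicator of [c = a]. *)
Lemma theta_inj f : (forall v, theta del f v = 0) -> f = 0.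
Proof.
move=> f0; apply: weylP => a; rewrite wcoef0.
have [aX|/wcoef_out //] := boolP (a \in wsupp f).
have [s sE] := del_pow_dense (fun c => (c == a)%:R) (fset_uniq (wsupp f)).
transitivity (\sum_(c <- wsupp f) wcoef f c * (c == a)%:R).
  rewrite (bigD1_seq a) //=; last exact: fset_uniq.
  by rewrite eqxx mulr1 big1 ?addr0 // => b /negPf ->; rewrite mulr0.
transitivity (\sum_(p <- s) p.1 * theta del f p.2).
  under [RHS]eq_bigr do rewrite /theta mulr_sumr.
  rewrite exchange_big; apply: eq_big_seq => c cX /=; rewrite -sE // mulr_sumr.
  by apply: eq_bigr => p _; rewrite mulrCA.
by rewrite big1 // => p _; rewrite f0 mulr0.
Qed.

Lemma theta_eq f g : (forall v, theta del f v = theta del g v) -> f = g.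
Proof.
move=> fg; apply/eqP; rewrite -subr_eq0; apply/eqP/theta_inj => v.
by rewrite thetaD thetaN fg subrr.
Qed.

(** To reach [y d^(b)], take [d^(a) = d_i^n d^(b)] with [n > 0], and by density
    [u_k], [v_k] such that [\sum_k u_k d^(c)(v_k)] vanishes for all divisors
    [d^(c)] of [d^(a)] except [d_i^n], where it is [y] divided by the binomial
    coefficient ['C(n + b_i, n)].  Then [\sum_k [u_k d^(a), v_k] = y d^(b)]. *)
Lemma brackets_with_A_span (i : I) (N : set (weyl A I)) : subspace N ->
  (forall u a v, N (weyl_lie del (wmon u a) (wmon v mone))) -> forall f, N f.
Proof.
move=> sN Nl f; rewrite [f]weyl_sum_mon; apply: subspace_sum => // b _.
set y := wcoef f b.
have [n n0 nz] := bin_neq0 F (b i) 1.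
pose g := iter n (mulcm (ucm i)) mone.
have gE j : g j = (n * (i == j))%N.
  rewrite /g; elim: (n) => [|m IH] /=; first by rewrite onecmE.
  by rewrite mulcmE ucmE IH mulSn.
pose a := mulcm g b; have ga : mon_le g a by move=> j; rewrite mulcmE leq_addr.
have g1 : g != mone.
  apply/eqP => /(congr1 (fun m : {cmonom I} => m i)).
  by rewrite gE cm1 eqxx muln1 => E; rewrite E in n0.
have bin : mon_bin a g = 'C(n + b i, n).
  have iX : i \in (i |` finsupp a)%fset by rewrite fset1U1.
  rewrite (mon_binEw ga (fsubsetUr [fset i]%fset _)) (big_fsetD1 i iX) /=.
  rewrite mulcmE gE eqxx muln1 big1_fset ?muln1 // => j; rewrite in_fsetD1.
  by case/andP => ji _ _; rewrite gE eq_sym (negPf ji) muln0 bin0.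
pose t c := if c == g then ('C(n + b i, n)%:R^-1 : F) *: y else 0.
have [s sE] := del_pow_dense t (fset_uniq (mdivs a)).
suff -> : wmon y b = \sum_(p <- s) weyl_lie del (wmon p.1 a) (wmon p.2 mone).
  by apply: subspace_sum.
apply: theta_eq => x; rewrite theta_mon // theta_sum.
under eq_bigr => p do rewrite theta_lie_mon //.
rewrite exchange_big /=.
transitivity (\sum_(c <- (mdivs a `\ mone)%fset)
   (mon_bin a c)%:R * (t c * del_pow del (divcm a c) x)); last first.
  apply: eq_big_seq => c; rewrite in_fsetD1 => /andP[_ ca].
  by rewrite -mulr_sumr -mulr_suml sE.
have gX : g \in (mdivs a `\ mone)%fset by rewrite in_fsetD1 g1; exact/mdivsP.
rewrite (big_fsetD1 g gX) /= /t eqxx bin mulcmK big1_fset => [|c]; last first.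
  by rewrite in_fsetD1 => /andP[/negPf -> _] _; rewrite mul0r mulr0.
rewrite addr0 mulrA; congr (_ * _).
by rewrite mulr_natl -scaler_nat scalerA mulfV ?scale1r.
Qed.

Lemma weyl_in_A f : (forall a, a <> mone -> wcoef f a = 0) ->
  f = wmon (theta del f 1) mone.
Proof.
move=> f0; have : f = wmon (wcoef f mone) mone.
  apply: weylP => a; rewrite wcoef_mon.
  by case: eqP => [<-|/nesym /f0 ->]; rewrite ?mulr1n ?mulr0n.
by move: (wcoef f mone) => u ->; rewrite theta_const mulr1.
Qed.

Lemma lie_const_mdeg f v n : (forall a, a \in wsupp f -> (mdeg a <= n.+1)%N) ->
  forall b, b \in wsupp (weyl_lie del f (wmon v mone)) -> (mdeg b <= n)%N.
Proof.
move=> fn b; apply: contraTT; rewrite -ltnNge => nb.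
rewrite -mcoeff_eq0 -/(wcoef _ b) weyl_lie_mon1r // wcoef_sum big_seq big1 //.
move=> a af; rewrite wcoef_sum big_seq big1 // => c; rewrite in_fsetD1.
case/andP => c1 /mdivsP ca; rewrite wcoef_mon; case: eqP => // E.
have := fn a af; rewrite -(divcmKC ca) E [mdeg _](mdegM c) leqNgt.
rewrite -mdeg_eq0 -lt0n in c1.
by rewrite -addn1 addnC (leq_trans _ (leq_add c1 nb)).
Qed.

(** The operator [del i] composed with [f] acts as zero, hence is zero.  Its
    coefficient at [d_i d^(a)] is [d_i(f_(d_i d^(a))) + f_a]; so each
    coefficient of [f] is minus a derivative of a coefficient of higher order,
    and all vanish because [f] has finite order. *)
Lemma theta_consts_eq0 (i : I) f :
  (forall v, consts D (theta del f v)) -> f = 0.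
Proof.
move=> fF; pose h : weyl A I := \sum_(a <- wsupp f)
  (wmon (del i (wcoef f a)) a + wmon (wcoef f a) (mulcm (ucm i) a)).
have h0 : h = 0.
  apply: theta_inj => v; rewrite /h theta_sum.
  rewrite -[RHS]((constsP hdel _).1 (fF v) i) (derivation_sum (derdel i)).
  apply: eq_bigr => a _; rewrite thetaD.
  by rewrite (derdel i).2 -del_pow_ucm //; congr (_ + _); exact: theta_mon.
have delta (E : {cmonom I} -> A) b : (b \notin wsupp f -> E b = 0) ->
    \sum_(a <- wsupp f) E a *+ (a == b) = E b.
  have [bX _|bX ->//] := boolP (b \in wsupp f).
    rewrite (bigD1_seq b) //= ?fset_uniq // eqxx big1 ?addr0 // => a /negPf ->.
    by rewrite mulr0n.
  rewrite big_seq big1 // => a aX.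
  by case: eqP aX bX => // -> ->.
have step a : wcoef f a = - del i (wcoef f (mulcm (ucm i) a)).
  apply/eqP; rewrite eq_sym -subr_eq0 -opprD oppr_eq0; apply/eqP.
  pose ia := mulcm (ucm i) a; rewrite -[RHS](wcoef0 A ia) -h0 wcoef_sum.
  transitivity (\sum_(b <- wsupp f)
      (del i (wcoef f b) *+ (b == ia) + wcoef f b *+ (b == a))); last first.
    apply: eq_bigr => b _; rewrite wcoefD -(inj_eq (@mulcm_inj _ (ucm i)) b a).
    by congr (_ + _); symmetry; exact: wcoef_mon.
  rewrite big_split /= (delta (wcoef f)) => [|/wcoef_out //].
  rewrite (delta (fun b => del i (wcoef f b))) 1?addrC // => /wcoef_out ->.
  exact: derivation0.
apply: weylP => a; rewrite wcoef0.
have [n] := ubnP (msize f - mdeg a); elim: n a => // n IH a le.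
have [/msize_mdeg_ge/wcoef_out//|lt] := leqP (msize f) (mdeg a).
rewrite step IH ?(derivation0 (derdel i)) ?oppr0 //.
by rewrite [mdeg _](mdegM (ucm i)) mdegU add1n subnS prednK ?subn_gt0.
Qed.

(** Descent on the order of [f].  Once all brackets of [f] with elements of [A]
    lie in [A], the bracket with [v] is the image of [v] under the operator [f]
    without its constant term, and [theta_consts_eq0] shows that not all these
    images are constants. *)
Lemma lie_ideal_meets_A (i : I) (N : set (weyl A I)) f :
  (forall g h, N g -> N (weyl_lie del g h)) -> N f ->
  (exists2 a, a <> mone & wcoef f a <> 0) ->
  exists2 v, N (wmon v mone) & ~ consts D v.
Proof.
move=> Nl; have [n] : exists n, forall a, a \in wsupp f -> (mdeg a <= n)%N.
  by exists (msize f) => a /msize_mdeg_lt/ltnW.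
elim: n f => [|n IH] f fn Nf [a a1 fa].
  have := fn a; rewrite leqn0 mdeg_eq0 => /(_ _)/eqP; move/wsuppP: fa => -> h.
  by case: a1; exact: h.
have [[v [b b1 fvb]]|noB] :=
    pselect (exists v, exists2 b, b <> mone &
      wcoef (weyl_lie del f (wmon v mone)) b <> 0).
  apply: (IH (weyl_lie del f (wmon v mone))); last by exists b.
    exact: lie_const_mdeg.
  exact: Nl.
have E v : weyl_lie del f (wmon v mone) =
    wmon (theta del f v - v * theta del f 1) mone.
  have := theta_lie_const derdel delC f v 1; rewrite mulr1 => <-.
  by apply: weyl_in_A => b b1; apply: contrapT => fb; apply: noB; exists v, b.
apply: contrapT => noV; case: fa.
pose w := wmon (theta del f 1) mone : weyl A I.
suff /eqP : f - w = 0.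
  by rewrite subr_eq0 => /eqP ->; rewrite wcoef_mon; case: eqP => // /esym.
apply: (theta_consts_eq0 i) => v; rewrite thetaD thetaN /w theta_const mulrC.
apply: contrapT => nF; apply: noV.
exists (theta del f v - v * theta del f 1) => //.
by rewrite -E; exact: Nl.
Qed.

(** The [y] with [A y] inside [N] form a D-stable ideal [J], because the bracket
    of [u d_j] and [y] is [u d_j(y)]; it contains some nonzero [d_i(v)]. *)
Lemma lie_ideal_contains_A (N : set (weyl A I)) : lie_ideal (weyl_lie del) N ->
  (exists2 v, N (wmon v mone) & ~ consts D v) -> forall u, N (wmon u mone).
Proof.
move=> [sN Nl] [v Nv vF].
have [i vi] : exists i, del i v <> 0.
  apply: contrapT => h; apply: vF; apply/(constsP hdel) => i.
  by apply: contrapT => vi; apply: h; exists i.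
pose J : set A := [set y | forall u, N (wmon (u * y) mone)].
have sJ : subspace J.
  split=> [u|k y z Jy Jz u].
    by rewrite mulr0 [wmon _ _]monalgU0; case: sN.
  rewrite mulrDr -scalerAr wmonP.
  by apply: sN.2; [exact: Jy|exact: Jz].
have br j u y : weyl_lie del (wmon u (ucm j)) (wmon y mone)
    = wmon (u * del j y) mone.
  have delE z : del_pow del (ucm j) z = del j z.
    by rewrite -[ucm j]mulcm0 del_pow_ucm // del_pow1.
  apply: theta_eq => x; rewrite [RHS]theta_const theta_lie_const //.
  rewrite (theta_mon del u (ucm j) (y * x)) (theta_mon del u (ucm j) x) !delE.
  by rewrite (derdel j).2 mulrDr [y * (u * _)]mulrCA addrK mulrA.
have NJ y : N (wmon y mone) -> forall j, J (del j y).
  by move=> Ny j u; rewrite -br; exact: (Nl _ _ Ny).1.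
have [|||d x Dd Jx|J0|JT u] := simpD (J := J).
- by case: sJ.
- exact: subspaceD.
- by move=> a x Jx u; rewrite mulrA; exact: Jx.
- have Nx : N (wmon x mone) by rewrite -[x]mul1r; exact: Jx.
  exact: (basis_span hdel Dd sJ (NJ x Nx)).
- by case: vi; have := NJ v Nv i; rewrite J0.
- by have : J 1; [rewrite JT|move=> /(_ u); rewrite mulr1].
Qed.

Lemma lie_ideal_full (i : I) (N : set (weyl A I)) :
  lie_ideal (weyl_lie del) N -> ~ (N `<=` @consts_wmon1 F A D I) ->
  forall f, N f.
Proof.
move=> NI nW; have [sN Nl] := NI; apply: (brackets_with_A_span i) => // u a v.
apply: (Nl _ _ _).1; apply: lie_ideal_contains_A => //.
have [f Nf Wf] : exists2 f, N f & ~ @consts_wmon1 F A D I f.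
  apply: contrapT => h; apply: nW => f Nf; apply: contrapT => Wf.
  by apply: h; exists f.
have [fa|nfa] := pselect (exists2 a, a <> mone & wcoef f a <> 0).
  by apply: (lie_ideal_meets_A i (f := f)) => // g x Ng; exact: (Nl x g Ng).2.
have fE : f = wmon (theta del f 1) mone.
  by apply: weyl_in_A => b b1; apply: contrapT => fb; apply: nfa; exists b.
exists (theta del f 1); first by rewrite -fE.
by move=> fF; apply: Wf; exists (theta del f 1).
Qed.

(** An ideal of the quotient pulls back to a Lie ideal of [weyl], which is made
    of constants or is everything.  If the quotient were abelian, all brackets
    would be constants; but they span the algebra, which contains [d_i]. *)
Lemma faithful_lie_simple (i : I) : lie_simple (weylbar_lie hD del).
Proof.
have hdelD := basis_in_D hdel; split; last first.
  move=> N [[N0 ND] Nl]; pose pi := @to_weylbar F A D hD I : weyl A I -> _.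
  have piK q : pi (repr q) = q by exact: to_quotsp_repr.
  pose K := pi @^-1` N.
  have piD k f g : pi (k *: f + g) = k *: pi f + pi g.
    by rewrite /pi /to_weylbar to_quotspD to_quotspZ.
  have pi0 : pi 0 = 0 by exact: to_weylbar0.
  have KI : lie_ideal (weyl_lie del) K.
    split.
      by split=> [|k f g Kf Kg]; rewrite /K /= ?pi0 // piD; exact: ND.
    move=> f g Kg; have := Nl (pi f) (pi g) Kg.
    by rewrite /pi -!to_weylbar_lie.
  have [KW|KW] := pselect (K `<=` @consts_wmon1 F A D I).
    left; apply/seteqP; split=> q /= => [Nq|->] //.
    rewrite -(piK q) -pi0; apply/to_quotspP; rewrite subr0; apply: KW.
    by rewrite /K /= piK.
  right; apply/seteqP; split=> // q _; rewrite -(piK q).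
  exact: (lie_ideal_full i KI KW).
apply: contrapT => ab.
have W u a v : @consts_wmon1 F A D I (weyl_lie del (wmon u a) (wmon v mone)).
  apply: contrapT => nW; apply: ab.
  exists (to_weylbar hD (wmon u a)), (to_weylbar hD (wmon v mone)).
  rewrite -to_weylbar_lie // => E; apply: nW; rewrite -[weyl_lie _ _ _]subr0.
  apply/(to_quotspP (consts_wmon1_subspace hD I)).
  by rewrite [LHS]E -to_weylbar0.
have sW := consts_wmon1_subspace hD I.
have Wi := brackets_with_A_span i sW W (wmon 1 (ucm i)).
have := const_coef Wi (@ucm_neq1 I i).
by rewrite wcoef_mon eqxx => /eqP; rewrite oner_eq0.
Qed.

End Sufficiency.

Theorem theorem1p1 (F : fieldType) (A : comAlgType F) (D : set (A -> A))
    (hD : spanned_by_commuting_ders D) (hD0 : exists2 d, D d & d <> 0)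
    (I : choiceType) (del : I -> A -> A) (hdel : is_basis D del) :
  lie_simple (weylbar_lie hD del) <->
  D_simple D /\ acts_faithfully del (consts_weyl D I).
Proof.
have [i di] : exists i, del i <> 0.
  have [d Dd d0] := hD0; apply: contrapT => h; apply: d0; apply/funext => x.
  apply: (basis_span hdel (P := [set 0]) Dd); first exact: subspace0.
  move=> i; apply: contrapT => dx; apply: h; exists i => E.
  by apply: dx; rewrite E.
split=> [simp|[simpD faithful]]; last exact: faithful_lie_simple.
split; first exact: (lie_simple_D_simple hdel i simp).
move=> f g _ _ fg; apply/eqP; rewrite -subr_eq0; apply/eqP.
apply: (lie_simple_faithful hdel di simp); apply/funext => x.
by rewrite thetaD thetaN fg subrr.
Qed.
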